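(* Let $\Gamma$ be an $n$-player game ($n\ge 2$) with finite nonempty pure strategy sets $S_1,\dots,S_n$ and payoff functions $A_1,\dots,A_n$, with $U^i>0$ for all $i\in[n]$. Consider the optimization problem in the variables $x^i_s,r^i_s,u^i_s,\overline{u}^i,f^i_s,g^i_s\in\mathbb{R}$ and $b^i_s\in\{0,1\}$ ($i\in[n]$, $s\in S_i$): $$\min\ \sum_{i=1}^n\sum_{s\in S_i}\big(f^i_s+g^i_s\big)$$ subject to $\sum_{s\in S_i}x^i_s=1$ for all $i\in[n]$ and, for all $i\in[n]$ and $s\in S_i$, $$u^i_s=\sum_{\hat{\mathbf{s}}\in S_{-i}}\prod_{s_j\in\hat{\mathbf{s}}}x^j_{s_j}A_i[s,\hat{\mathbf{s}}],\qquad \overline{u}^i\ge u^i_s,\qquad r^i_s=\overline{u}^i-u^i_s,\qquad x^i_s\ge 0,\qquad r^i_s\ge 0,$$ $$f^i_s\ge r^i_s/U^i,\qquad f^i_s\ge b^i_s,\qquad g^i_s\ge x^i_s,\qquad g^i_s\ge 1-b^i_s.$$ The set of Nash equilibria minimizes the objective function of this problem; that is, $\mathbf{x}=(x^i_s)_{i\in[n],s\in S_i}$ is a (mixed) Nash equilibrium of $\Gamma$ if and only if there exist values of $r^i_s,u^i_s,\overline{u}^i,f^i_s,g^i_s,b^i_s$ which together with $\mathbf{x}$ form an optimal solution (global minimizer) of the problem.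
   Context: Let $[n]=\{1,\dots,n\}$ be the set of players. Player $i$ has a finite nonempty set $S_i$ of pure strategies. $S_{-i}=S_1\times\dots\times S_{i-1}\times S_{i+1}\times\dots\times S_n$ is the set of pure strategy tuples of all players other than $i$. The payoff function of player $i$ is $A_i:S_1\times\dots\times S_n\to\mathbb{R}$; for $s\in S_i$ and $\hat{\mathbf{s}}\in S_{-i}$, $A_i[s,\hat{\mathbf{s}}]$ is the payoff of player $i$ when $i$ plays $s$ and the others play $\hat{\mathbf{s}}$. For $\hat{\mathbf{s}}=(s_j)_{j\ne i}\in S_{-i}$, the notation $\prod_{s_j\in\hat{\mathbf{s}}}x^j_{s_j}$ means $\prod_{j\ne i}x^j_{s_j}$. The constant $U^i=\max_{s^l,s^h\in S_i,\ \hat{\mathbf{s}}^l,\hat{\mathbf{s}}^h\in S_{-i}}\big(A_i[s^h,\hat{\mathbf{s}}^h]-A_i[s^l,\hat{\mathbf{s}}^l]\big)$ is the maximum difference of any two payoffs of player $i$. A mixed strategy of player $i$ is a vector $\mathbf{x}^i=(x^i_s)_{s\in S_i}$ with $x^i_s\ge 0$ and $\sum_{s\in S_i}x^i_s=1$ (pure strategies are special cases). A mixed strategy profile is a tuple $\mathbf{x}=(\mathbf{x}^1,\dots,\mathbf{x}^n)$ of mixed strategies; player $i$'s expected payoff is $\mathbb{E}[A_i[\mathbf{x}]]=\sum_{s\in S_i}x^i_s\sum_{\hat{\mathbf{s}}\in S_{-i}}A_i[s,\hat{\mathbf{s}}]\prod_{s_j\in\hat{\mathbf{s}}}x^j_{s_j}$.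 A profile $\mathbf{x}$ is a (mixed) Nash equilibrium if for every player $i$ and every mixed strategy $\mathbf{y}^i$ of player $i$, $\mathbb{E}[A_i[\mathbf{x}]]\ge\mathbb{E}[A_i[\mathbf{y}^i,\mathbf{x}^{-i}]]$, where $(\mathbf{y}^i,\mathbf{x}^{-i})$ is $\mathbf{x}$ with $\mathbf{x}^i$ replaced by $\mathbf{y}^i$. *)

(* Defs.v *)
From HB Require Import structures.
From mathcomp Require Import all_boot all_order all_algebra.
From mathcomp Require Import reals.

Set Implicit Arguments.
Unset Strict Implicit.
Unset Printing Implicit Defensive.

Import Order.TTheory GRing.Theory Num.Theory.
Local Open Scope ring_scope.

Section Game.

Variables (R : realType) (n : nat) (S : 'I_n -> finType).

Definition pure_profile := {dffun forall j : 'I_n, S j}.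

(* The product S_{-i} of the strategy sets of all players j <> i. *)
Definition others (i : 'I_n) :=
  {dffun forall j : {j : 'I_n | j != i}, S (val j)}.

(* The full tuple (s, t) in which i plays s and the other players play t;
   characterized by [joinE] and [join_othersE]. *)
Definition join (i : 'I_n) (s : S i) (t : others i) : pure_profile :=
  [ffun j : 'I_n =>
    match decP (j =P i) with
    | left e => eq_rect_r (fun k => S k : Type) s e
    | right ne => t (Sub j (introN eqP ne))
    end].

Lemma joinE (i : 'I_n) (s : S i) (t : others i) : join s t i = s.
Proof.
rewrite /join ffunE; case: decP => // e.
by rewrite (eq_axiomK e).
Qed.

Lemma join_othersE (i : 'I_n) (s : S i) (t : others i)
  (j : {j : 'I_n | j != i}) : join s t (val j) = t j.
Proof.
rewrite /join ffunE; case: j => j hj /=; case: decP => [e|ne].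
  by exfalso; move: hj; rewrite e eqxx.
by rewrite (bool_irrelevance (introN eqP ne) hj).
Qed.

(* A i p is the payoff of player i at the pure profile p. *)
Variable A : 'I_n -> pure_profile -> R.

(* Starting the maximum at 0 is harmless: 0 is the difference of any payoff
   with itself, hence belongs to the (nonempty) family. *)
Definition max_payoff_diff (i : 'I_n) : R :=
  \big[Num.max/0]_(q : (S i * others i) * (S i * others i))
    (A i (join q.2.1 q.2.2) - A i (join q.1.1 q.1.2)).

Definition mixed_profile := forall i : 'I_n, S i -> R.

Definition is_mixed_strategy (i : 'I_n) (y : S i -> R) : Prop :=
  (forall s, 0 <= y s) /\ \sum_(s : S i) y s = 1.

(* Expected payoff of player i for the pure strategy s against x^{-i}. *)
Definition pure_payoff (x : mixed_profile) (i : 'I_n) (s : S i) : R :=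
  \sum_(t : others i)
    (\prod_(j : {j : 'I_n | j != i}) x (val j) (t j)) * A i (join s t).

Definition expected_payoff (x : mixed_profile) (i : 'I_n) : R :=
  \sum_(s : S i) x i s * pure_payoff x s.

(* [dfwith x y] is x with its i-th component replaced by y : S i -> R. *)
Definition nash_equilibrium (x : mixed_profile) : Prop :=
  (forall i, is_mixed_strategy (x i)) /\
  forall (i : 'I_n) (y : S i -> R), is_mixed_strategy y ->
    expected_payoff (dfwith x y) i <= expected_payoff x i.

Record variables := Variables {
  var_x : forall i : 'I_n, S i -> R;
  var_r : forall i : 'I_n, S i -> R;
  var_u : forall i : 'I_n, S i -> R;
  var_ubar : 'I_n -> R;
  var_f : forall i : 'I_n, S i -> R;
  var_g : forall i : 'I_n, S i -> R;
  var_b : forall i : 'I_n, S i -> bool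
}.

Definition objective (v : variables) : R :=
  \sum_(i < n) \sum_(s : S i) (var_f v s + var_g v s).

Definition feasible (v : variables) : Prop :=
  (forall i : 'I_n, \sum_(s : S i) var_x v s = 1) /\
  (forall (i : 'I_n) (s : S i),
    var_u v s = pure_payoff (var_x v) s /\
    var_ubar v i >= var_u v s /\
    var_r v s = var_ubar v i - var_u v s /\
    var_x v s >= 0 /\
    var_r v s >= 0 /\
    var_f v s >= var_r v s / max_payoff_diff i /\
    var_f v s >= (var_b v s)%:R /\
    var_g v s >= var_x v s /\
    var_g v s >= 1 - (var_b v s)%:R).

Definition optimal (v : variables) : Prop :=
  feasible v /\ forall w : variables, feasible w -> objective v <= objective w.

End Game.

(* Main.v *)
(** Every pair (i, s) contributes at least 1 to the objective, whatever the
    value of b, and contributes exactly 1 iff s is played with probability 0 or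
    has regret 0.  Hence the objective is at least the total number of pure
    strategies, with equality exactly at Nash equilibria, and the theorem reduces
    to the existence of an equilibrium.

    Existence is Scarf's argument.  Grid points of a simplex, ordered along each
    coordinate with ties broken, together with one slack vector per coordinate,
    form a system of linear orders in which "dominating" sets play the role of
    the cells of a triangulation; a parity count produces a dominating set of all
    colours.  Its grid points are close to each other, so refining the grid shows
    that closed sets K_i covering a simplex admit a point z with z_i = 0 or
    z in K_i for every i.  One takes a single simplex indexed by all pairs (i, s)
    and lets K_(i, s) say that s is a best reply of player i to n z and that
    player i has total weight at most 1/n; these weights are then all equal
    to 1/n, and n z is an equilibrium. *)
Require Import Defs.
From mathcomp Require Import all_boot all_order all_algebra.
From mathcomp Require Import reals.
From mathcomp Require Import zify.

Set Implicit Arguments.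
Unset Strict Implicit.
Unset Printing Implicit Defensive.

(** * Parity counting and Scarf's lemma on systems of linear orders *)

Lemma odd_sum_exists (T : finType) (P : pred T) (F : T -> nat) :
  odd (\sum_(t | P t) F t) -> exists2 t, P t & odd (F t).
Proof.
move=> H; apply/exists_inP; apply: contraT => /exists_inPn K; move: H.
by apply: (big_ind (fun k => odd k -> false)) => // [a b|t /K /negbTE ->//];
  rewrite oddD; case: (odd a); case: (odd b) => //= *; auto.
Qed.

Section Scarf.

Variables (V I : finType) (rk : I -> V -> nat).
Hypothesis rk_inj : forall i, injective (rk i).

(** For nonempty [X]: no [y] lies strictly above the minimum of [X] in all orders at once, as in
    Scarf's primitive sets. *)
Definition dominating (X : {set V}) :=
  [forall y, exists i, forall x in X, rk i y <= rk i x].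

Lemma dominatingP (X : {set V}) :
  reflect (forall y, exists i, forall x, x \in X -> rk i y <= rk i x)
          (dominating X).
Proof.
apply: (iffP forallP) => H y.
  by have /existsP [i /forall_inP Hi] := H y; exists i.
by have [i Hi] := H y; apply/existsP; exists i; apply/forall_inP.
Qed.

Lemma dominatingS (X Y : {set V}) :
  X \subset Y -> dominating Y -> dominating X.
Proof.
move=> /subsetP sXY /dominatingP dY; apply/dominatingP => y.
by have [i Hi] := dY y; exists i => x /sXY /Hi.
Qed.

(* Two indices a, b have the same minimum in Y; the elements completing Y are the
   rk a-largest element above the minima of all indices other than a, and the
   same for b. The third hypothesis makes both exist. *)
Lemma even_completions (Y : {set V}) :
  0 < #|Y| -> #|Y|.+1 = #|I| ->
  (forall (m : I -> V) a, (forall i, m i \in Y) ->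
     (forall i x, x \in Y -> rk i (m i) <= rk i x) ->
     exists y, forall i, i != a -> rk i (m i) < rk i y) ->
  ~~ odd #|[set x | (x \notin Y) && dominating (x |: Y)]|.
Proof.
move=> /card_gt0P [y0 y0Y] cY upper.
have [/dominatingP dY|ndY] := boolP (dominating Y); last first.
  rewrite (_ : [set x | _] = set0) ?cards0 //; apply/setP => x.
  rewrite !inE; apply/negP => /andP [_ H]; case/negP: ndY.
  by apply: dominatingS H; apply: subsetUr.
pose m i := [arg min_(x < y0 in Y) rk i x].
have mY i : m i \in Y by rewrite /m; case: arg_minnP.
have m_min i x : x \in Y -> rk i (m i) <= rk i x.
  by move: x; rewrite /m; case: arg_minnP.
have m_eq i y : y \in Y -> (forall x, x \in Y -> rk i y <= rk i x) -> m i = y.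
  by move=> yY H; apply: (@rk_inj i); have := m_min i y yY; have := H _ (mY i); lia.
have m_im : m @: setT = Y.
  apply/setP => y; apply/imsetP/idP => [[i _ ->]//|yY].
  by have [i Hi] := dY y; exists i => //; rewrite (m_eq _ _ yY Hi).
have [a [b [ab mab]]] : exists a b, a != b /\ m a = m b.
  have : ~~ injectiveb m.
    apply/negP => /injectiveP im; have := card_imset setT im.
    by rewrite m_im cardsT; lia.
  by case/injectivePn => a [b ab mab]; exists a, b.
pose M j := [set y | [forall (i | i != j), rk i (m i) < rk i y]].
have inM j y : reflect (forall i, i != j -> rk i (m i) < rk i y) (y \in M j).
  by rewrite inE; apply: forall_inP.
have M_low j y i : y \in M j -> (forall x, x \in Y -> rk i y <= rk i x) -> i = j.
  move=> /inM H Hi; apply/eqP/negPn/negP => /H.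
  by have := Hi _ (mY i); lia.
have m_sur j y : j \in [:: a; b] -> y \in Y -> exists2 k, k != j & m k = y.
  move=> jab; rewrite -m_im => /imsetP [i _ ->].
  have [->|ij] := eqVneq i j; last by exists i.
  by move: jab; rewrite !inE => /orP [] /eqP ->; [exists b|exists a];
    rewrite // eq_sym.
have dom_M x j : j \in [:: a; b] -> x \in M j ->
    (forall y, y \in M j -> rk j y <= rk j x) ->
    (x \notin Y) && dominating (x |: Y).
  move=> jab xM xmax; apply/andP; split.
    apply/negP => /(m_sur _ _ jab) [k kj mk].
    by move/inM: xM => /(_ _ kj); rewrite mk ltnn.
  (* In order [j], [x] is at most every element of [Y], and any [y] in [M j] is at most [x]. Any
     other [y] is at most some minimum [m i] with [i != j], and [x] exceeds that minimum. *)
  apply/dominatingP => y; have [yM|yM] := boolP (y \in M j).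
    exists j => z /setU1P [->|zY]; first exact: xmax.
    have [i Hi] := dY x; have ij := M_low _ _ _ xM Hi.
    by rewrite ij in Hi; apply: leq_trans (Hi z zY); apply: xmax.
  move: yM; rewrite inE negb_forall_in => /exists_inP [i ij]; rewrite -leqNgt => yi.
  exists i => z /setU1P [->|zY]; last by apply: leq_trans yi (m_min _ _ zY).
  by apply: leq_trans yi (ltnW _); move/inM: xM; apply.
have M_dom x : x \notin Y -> dominating (x |: Y) ->
    exists j, [/\ j \in [:: a; b], x \in M j &
               forall y, y \in M j -> rk j y <= rk j x].
  (* Each [y] in [Y] is least in [x |: Y] for an order [k y], never for [j]. As [Y] has one element
     fewer than [I], [k] is a bijection from [Y] onto the indices other than [j]. *)
  move=> xY /dominatingP dxY; have [j Hj] := dY x.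
  have lowY i y : (forall z, z \in x |: Y -> rk i y <= rk i z) ->
      forall z, z \in Y -> rk i y <= rk i z.
    by move=> H z zY; apply: H; rewrite in_setU1 zY orbT.
  have [k Hk] : exists k : V -> I, forall y z, z \in x |: Y ->
      rk (k y) y <= rk (k y) z.
    have /fin_all_exists [k Hk] : forall y, exists i, forall z, z \in x |: Y ->
      rk i y <= rk i z by move=> y; apply: dxY.
    by exists k.
  have mk y : y \in Y -> m (k y) = y.
    by move=> yY; apply: m_eq => // z zY; apply: Hk; rewrite in_setU1 zY orbT.
  have kj y : y \in Y -> k y != j.
    move=> yY; apply/negP => /eqP kyj; case/negP: xY.
    suff -> : x = y by [].
    apply: (@rk_inj j); have := Hj y yY.
    by have := Hk y x (setU11 _ _); rewrite kyj; lia.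
  have kim : k @: Y = ~: [set j].
    apply/eqP; rewrite eqEcard; apply/andP; split.
      by apply/subsetP => _ /imsetP [y yY ->]; rewrite !inE kj.
    rewrite card_in_imset; last by move=> y z yY zY kyz; rewrite -(mk y) // kyz mk.
    by rewrite cardsC1 -cY.
  have k_sur i : i != j -> exists2 y, y \in Y & i = k y.
    move=> ij; have : i \in k @: Y by rewrite kim !inE.
    by case/imsetP => y; exists y.
  exists j; split.
  - rewrite !inE; apply/negPn/negP; rewrite negb_or => /andP [].
    rewrite eq_sym => /k_sur [y yY ay]; rewrite eq_sym => /k_sur [z zY bz].
    by case/negP: ab; rewrite ay bz -(mk y) // -(mk z) // -ay -bz mab.
  - apply/inM => i /k_sur [y yY ->]; rewrite mk // ltn_neqAle Hk ?setU11 // andbT.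
    by apply/eqP => /rk_inj yx; rewrite -yx yY in xY.
  - move=> y yM; have [i Hi] := dxY y.
    have <- := M_low _ _ _ yM (lowY _ _ Hi).
    by apply: Hi; apply: setU11.
have [xs Hxs] : exists xs : I -> V, forall j, xs j \in M j /\
    forall y, y \in M j -> rk j y <= rk j (xs j).
  apply: (@fin_all_exists _ _ (fun j x => x \in M j /\
    forall y, y \in M j -> rk j y <= rk j x)) => j.
  have [y Hy] := upper m j mY m_min.
  have yM : y \in M j by apply/inM.
  by exists [arg max_(x > y in M j) rk j x]; case: arg_maxnP.
have -> : [set x | (x \notin Y) && dominating (x |: Y)] = [set xs a; xs b].
  apply/setP => x; rewrite !inE; apply/andP/orP => [[xY xd]|].
    have [j [jab xM xmax]] := M_dom x xY xd.
    have xj : x = xs j.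
      apply: (@rk_inj j); have [H1 H2] := Hxs j.
      by have := xmax _ H1; have := H2 _ xM; lia.
    by move: jab; rewrite !inE xj => /orP [] /eqP ->; rewrite eqxx; [left|right].
  have [Ha Ha'] := Hxs a; have [Hb Hb'] := Hxs b.
  by case=> /eqP ->; apply/andP; [apply: (dom_M _ a)|apply: (dom_M _ b)] => //;
    rewrite !inE eqxx ?orbT.
(* If they coincided, the order in which this element is at most all of [Y] would have to be both
   [a] and [b]. *)
rewrite cards2; suff -> : xs a != xs b by [].
apply/eqP => xab; have [j Hj] := dY (xs a).
have [Ha _] := Hxs a; have [Hb _] := Hxs b; rewrite -xab in Hb.
by case/eqP: ab; rewrite -(M_low _ _ _ Ha Hj) (M_low _ _ _ Hb Hj).
Qed.

Variables (e : I -> V) (c : V -> I) (v0 : V).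
(* [e i] are the slack vectors: [e i] is the least element of the order [rk i],
   and lies above all non-slack elements in the other orders. *)
Hypothesis e_min : forall i v, v != e i -> rk i (e i) < rk i v.
Hypothesis e_top : forall i j v, v \notin codom e -> j != i -> rk i v < rk i (e j).
Hypothesis ce : cancel e c.
Hypothesis v0_e : v0 \notin codom e.

(** If removing [x0] leaves each colour except [i0] exactly once, then [x0] has the colour of a
    unique other element [x1], since [X] misses a colour. Removing [x0] or [x1] are the only two
    choices. *)
Lemma even_facets (i0 : I) (X : {set V}) : #|X| = #|I| -> c @: X != setT ->
  ~~ odd #|[set x in X | c @: (X :\ x) == ~: [set i0]]|.
Proof.
move=> cX nT; set A := [set x in X | _].
have [->|[x0]] := set_0Vmem A; first by rewrite cards0.
rewrite inE => /andP [x0X /eqP im0].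
have inj x : x \in X -> c @: (X :\ x) = ~: [set i0] -> {in X :\ x &, injective c}.
  move=> xX im; apply/imset_injP; rewrite im cardsC1 -cX (cardsD1 x X) xX.
  by rewrite add1n.
have /imsetP [x1 x1X c01] : c x0 \in c @: (X :\ x0).
  rewrite im0 !inE; apply: contra nT => /eqP c0.
  rewrite -(setD1K x0X) imsetU1 im0 c0; apply/eqP/setP => i.
  by rewrite !inE orbN.
have [x10 x1X'] := setD1P x1X.
suff -> : A = [set x0; x1] by rewrite cards2 eq_sym x10.
apply/setP => x; rewrite !inE; apply/andP/orP => [[xX /eqP im]|].
  have [->|x0x] := eqVneq x x0; first by left.
  have [_|x1x] := eqVneq x x1; first by right.
  case/eqP: x10; apply: (inj x xX im); rewrite ?inE ?x0X ?x1X' // 1?eq_sym ?x1x //.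
  by rewrite x0x.
case=> /eqP ->; first by rewrite x0X im0.
split=> //; rewrite -im0; apply/eqP/setP => i; apply/imsetP/imsetP => -[y].
  move=> /setD1P [yx1 yX] ->; have [->|yx0] := eqVneq y x0; first by exists x1.
  by exists y; rewrite // !inE yx0.
move=> /setD1P [yx0 yX] ->; have [->|yx1] := eqVneq y x1.
  by exists x0; rewrite // !inE eq_sym x10.
by exists y; rewrite // !inE yx1.
Qed.

(** If every room missed a colour, the count over rooms would be even by [even_facets]. Counted over
    the sets [X :\ x] it is odd, since [even_completions] applies to all of them but [Y0]. *)
Lemma scarf : exists X : {set V},
  [/\ dominating X, #|X| = #|I| & c @: X = setT].
Proof.
pose i0 := c v0.
pose good (Y : {set V}) := c @: Y == ~: [set i0].
pose room (X : {set V}) := dominating X && (#|X| == #|I|).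
pose cnt (X : {set V}) := #|[set x in X | good (X :\ x)]|.
pose cnt' (Y : {set V}) := #|[set x | (x \notin Y) && dominating (x |: Y)]|.
(* Pairs (X, x) with X a room and [good (X :\ x)] are counted by X and by X :\ x;
   Y0 is the only good set that lies in an odd number of rooms. *)
pose Y0 := e @: ~: [set i0].
have e_inj : injective e by apply: can_inj ce.
have I_gt0 : 0 < #|I| by apply/card_gt0P; exists i0.
suff : odd (\sum_(X | room X) cnt X).
  move/odd_sum_exists => [X /andP [dX /eqP cX] oX]; exists X; split=> //.
  by apply/eqP; apply: contraLR oX; apply: even_facets.
have -> : \sum_(X | room X) cnt X =
    \sum_(Y : {set V} | (#|Y|.+1 == #|I|) && good Y) cnt' Y.
  transitivity (\sum_(X | room X) \sum_(x | (x \in X) && good (X :\ x)) 1).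
    by apply: eq_bigr => X _; rewrite /cnt -sum1dep_card.
  transitivity (\sum_(Y : {set V} | (#|Y|.+1 == #|I|) && good Y)
     \sum_(x | (x \notin Y) && dominating (x |: Y)) 1); last first.
    by apply: eq_bigr => X _; rewrite /cnt' -sum1dep_card.
  rewrite (exchange_big_dep predT) //= [RHS](exchange_big_dep predT) //=.
  apply: eq_bigr => x _.
  rewrite (reindex_onto (fun Y => x |: Y) (fun X => X :\ x)) /=; last first.
    by move=> X /andP [_ /andP [xX _]]; rewrite setD1K.
  apply: eq_bigl => Y; rewrite /room setU11 /=.
  have [xY|xY] := boolP (x \in Y).
    rewrite !andbF; apply/negP => /andP [_ /eqP YE].
    by move: xY; rewrite -YE !inE eqxx.
  have -> : (x |: Y) :\ x = Y by apply: setU1K.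
  by rewrite eqxx cardsU1 xY andbT add1n /= -andbA andbC.
have Y0good : (#|Y0|.+1 == #|I|) && good Y0.
  rewrite /Y0 /good card_imset // cardsC1 prednK // eqxx /=; apply/eqP/setP => i.
  rewrite -imset_comp (eq_imset (g := id)) ?imset_id //.
rewrite (bigD1 Y0) //= oddD; set rest := \sum_(i | _) _.
have -> : odd rest = false.
  apply/negbTE; apply: contraT; rewrite negbK => /odd_sum_exists [Y].
  move=> /andP [/andP [/eqP cY gY] YY0]; apply: contraLR => _.
  have Y_gt0 : 0 < #|Y|.
    rewrite card_gt0; apply: contra YY0 => /eqP Y_0.
    have /andP [/eqP cY0 _] := Y0good.
    by move: cY; rewrite -cY0 Y_0 cards0 eq_sym -cards_eq0 => -[<-].
  (* The slack vector [e a] is the required upper element. In order [i != a] it exceeds non-slack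
     elements and [e i]; a good [Y] of this size containing none of these would be [Y0]. *)
  apply: even_completions => // m a mY m_min; exists (e a) => i ia.
  have [y yY Hy] : exists2 y, y \in Y & rk i y < rk i (e a).
    suff /exists_inP [y yY Hy] : [exists y in Y, (y \notin codom e) || (y == e i)].
      exists y => //; case/orP: Hy => [/e_top|/eqP ->]; first by apply; rewrite eq_sym.
      by apply: e_min; rewrite (inj_eq e_inj) eq_sym.
    apply: contraT => /exists_inPn Hn.
    have YE : Y = e @: ~: [set i].
      apply/eqP; rewrite eqEcard card_imset // cardsC1 -cY leqnn andbT.
      apply/subsetP => y /Hn; rewrite negb_or negbK => /andP [/codomP [k ->] ki].
      by rewrite imset_f // !inE; apply: contra ki => /eqP ->.
    case/negP: YY0; move/eqP: gY; rewrite YE -imset_comp.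
    rewrite (eq_imset (g := id)) ?imset_id //.
    by move/setC_inj/set1_inj => ->.
  exact: leq_ltn_trans (m_min _ _ yY) Hy.
rewrite addbF /cnt'.
(* The only completion of [Y0] is the [rk i0]-largest non-slack element: [vm] can be dominated only
   in order [i0], because each other order has its least element in [Y0]. *)
have [vm [vmE vmax]] : exists v, v \notin codom e /\
    forall w, w \notin codom e -> rk i0 w <= rk i0 v.
  by exists [arg max_(v > v0 | v \notin codom e) rk i0 v]; case: arg_maxnP.
suff -> : [set x | (x \notin Y0) && dominating (x |: Y0)] = [set vm] by rewrite cards1.
have inY0 j : j != i0 -> e j \in Y0 by move=> ji; rewrite imset_f // !inE.
apply/setP => x; rewrite !inE; apply/andP/eqP => [[xY /dominatingP xd]|->].
  have [i Hi] := xd vm.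
  have ii0 : i = i0.
    apply/eqP; apply: contraT => /inY0 eY; have := Hi (e i); rewrite in_setU1 eY orbT.
    move=> /(_ isT); rewrite leqNgt e_min //.
    by apply: contra vmE => /eqP ->; apply: codom_f.
  rewrite ii0 in Hi; have := Hi x (setU11 _ _) => vx.
  have xE : x \notin codom e.
    apply: contra xY => /codomP [j xj]; rewrite xj inY0 //.
    apply/eqP => ji; move: vx; rewrite xj ji leqNgt e_min //.
    by apply: contra vmE => /eqP ->; apply: codom_f.
  by apply: (@rk_inj i0); have := vmax _ xE; lia.
split.
  by apply: contra vmE => /imsetP [j _ ->]; apply: codom_f.
apply/dominatingP => y; have [/codomP [i ->]|yE] := boolP (y \in codom e).
  by exists i => z _; have [->//|/e_min/ltnW] := eqVneq z (e i).
exists i0 => z /setU1P [->|/imsetP [j]]; first exact: vmax.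
by rewrite !inE => ji ->; apply: ltnW; apply: e_top.
Qed.

End Scarf.

(** * Grid points of a simplex *)

Lemma leq_sum1 (I : finType) (P : pred I) (F : I -> nat) (i : I) :
  P i -> F i <= \sum_(j | P j) F j.
Proof. by move=> Pi; rewrite (bigD1 i) //= leq_addr. Qed.

Section Grid.

Variables (I : finType) (N : nat).

(** Lattice points of the simplex dilated by [N]. The range ['I_N.+1] makes them finite in number
    and excludes none, since no coordinate exceeds the sum. *)
Definition grid_point (p : {ffun I -> 'I_N.+1}) := \sum_i p i == N.

Lemma grid_point_exists (F : I -> nat) :
  \sum_i F i = N -> exists2 p, grid_point p & forall i, p i = F i :> nat.
Proof.
move=> FN; have pF i : nat_of_ord ([ffun i => inord (F i)] i : 'I_N.+1) = F i.
  by rewrite ffunE inordK // ltnS -FN leq_sum1.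
exists [ffun i => inord (F i)] => //.
by rewrite /grid_point (eq_bigr F) ?FN.
Qed.

(** In the set [X] given by [scarf], either the slack vector [i] is present and coordinate [i] is
    small on all grid points of [X], or colour [i] is carried by a grid point of [X]. *)
Lemma colourful_grid_points (c : {ffun I -> 'I_N.+1} -> I) : 0 < #|I| ->
  exists2 p, grid_point p & forall i, p i <= #|I| \/
    exists q, [/\ grid_point q, c q = i &
      forall j, p j <= q j + #|I| /\ q j <= p j + #|I|].
Proof.
move=> /card_gt0P [i0 _].
pose G := {p : {ffun I -> 'I_N.+1} | grid_point p}.
pose V := (G + I)%type.
have [K [tie [tie_inj tieK]]] : exists K (t : G -> nat), injective t /\ forall p, t p < K.
  exists #|{: G}|, (fun p => nat_of_ord (enum_rank p)).
  by split=> // p q /val_inj/enum_rank_inj.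
(* As [K] exceeds every tie value, grid points are compared by coordinate [i], then by [tie]. The
   successors leave 0 to slack vector [i] and put the other slack vectors above all grid points. *)
pose rk i (v : V) := match v with
  | inl p => (val p i * K + tie p).+1
  | inr j => if j == i then 0 else (N.+1 * K + enum_rank j).+1 end.
have rkG i p : rk i (inl p) <= N.+1 * K.
  have := tieK p; have := ltn_ord (val p i); rewrite /=; nia.
have rk_le i (p q : G) : rk i (inl p) <= rk i (inl q) -> val p i <= val q i.
  by have := tieK p; have := tieK q; rewrite /=; nia.
have rk_inj i : injective (rk i).
  have L p j : rk i (inl p) <> rk i (inr j).
    by have := rkG i p; rewrite /=; case: ifP => _; lia.
  move=> [p|j] [q|k] H.
  - congr inl; apply: tie_inj.
    have := rk_le i p q; have := rk_le i q p; rewrite H leqnn => /(_ isT) h1 /(_ isT) h2.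
    have pq : val p i = val q i :> nat by lia.
    by move: H; rewrite /= in pq *; rewrite pq; lia.
  - by case: (L p k).
  - by case: (L q j).
  congr inr; move: H => /=; case: eqP => [->|_]; case: eqP => [->|_] //.
  by move=> H; apply: enum_rank_inj; apply: val_inj => /=; lia.
have inrE (v : V) : v \notin codom inr -> exists p, v = inl p.
  case: v => [p|j] H; first by exists p.
  by rewrite codom_f in H.
have [p0 p0G p0E] : exists2 p, grid_point p & forall i, p i = (i == i0) * N :> nat.
  apply: grid_point_exists; rewrite (bigD1 i0) //= big1 ?eqxx; first by lia.
  by move=> i /negbTE ->.
pose col (v : V) := match v with inl p => c (val p) | inr j => j end.
have v0E : inl (Sub p0 p0G : G) \notin codom (inr : I -> V) by apply/codomP => -[].
have e_min i v : v != inr i -> rk i (inr i) < rk i v.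
  by case: v => [p|j] //=; rewrite eqxx //; case: (j == i) /eqP => [->|]; rewrite ?eqxx.
have e_top i j v : v \notin codom inr -> j != i -> rk i v < rk i (inr j).
  move=> /inrE [p ->] /negbTE ji; have := rkG i p; rewrite /= ji; lia.
have [X [/dominatingP dX cX colX]] :=
  scarf rk_inj e_min e_top (fun _ => erefl : col (inr _) = _) v0E.
pose C := [set i | inr i \notin X].
have [p1 p1X] : exists p, inl p \in X.
  apply/existsP; apply: contraT; rewrite negb_exists => /forallP nX.
  have [i Hi] := dX (inl (Sub p0 p0G : G)).
  have XE : X = inr @: [set: I].
    apply/eqP; rewrite eqEcard card_imset ?cardsT ?cX ?leqnn ?andbT;
      last by move=> ? ? [].
    by apply/subsetP => -[p|j] //; [rewrite (negbTE (nX p))|rewrite imset_f].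
  by have := Hi (inr i); rewrite XE imset_f ?inE // => /(_ isT); rewrite /= eqxx.
have C_rk i y : (forall x, x \in X -> rk i (inl y) <= rk i x) -> i \in C.
  rewrite inE => Hi; apply/negP => /Hi; by rewrite /= eqxx.
pose m i := val [arg min_(p < p1 | inl p \in X) val p i] i.
have m_in i : exists2 p, inl p \in X & m i = val p i.
  by rewrite /m; case: arg_minnP => // p pX _; exists p.
have m_min i p : inl p \in X -> m i <= val p i.
  by move: p; rewrite /m; case: arg_minnP => // p pX H q; apply: H.
have [k kC] : exists k, k \in C by have [i /C_rk] := dX (inl p1); exists i.
(* A lower bound for coordinate [i] on the grid points of [X], taken to be 0 when slack vector [i]
   is in [X]. *)
pose mC i := (i \in C) * m i.
have mC_min i p : inl p \in X -> mC i <= val p i.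
  by move=> /m_min H; rewrite /mC; case: (i \in C); rewrite ?mul1n ?mul0n.
(* Otherwise some grid point exceeds the minima m on all of C, against domination. *)
have N_lt : N < \sum_i mC i + #|I|.
  rewrite ltnNge; apply/negP => CN.
  (* The excess [d] goes to one coordinate [k] in [C], so that the sum is exactly [N]. *)
  pose d := N - \sum_i (i \in C) * (m i).+1.
  have mCN : \sum_i (i \in C) * (m i).+1 <= N.
    apply: leq_trans CN; rewrite -sum1_card -big_split /=.
    by apply: leq_sum => i _; rewrite /mC; case: (i \in C); lia.
  have [|y yG yE] := @grid_point_exists (fun i => (i \in C) * (m i).+1 + (i == k) * d).
    rewrite big_split /= [X in _ + X](bigD1 k) //= eqxx mul1n.
    rewrite [X in _ + (_ + X)]big1 ?addn0 ?subnKC // => i /negbTE -> //.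
  have [i Hi] := dX (inl (Sub y yG : G)).
  have iC := C_rk _ _ Hi; have [p pX mp] := m_in i.
  by have := rk_le _ _ _ (Hi _ pX); rewrite -mp SubK yE iC; lia.
(* The lower bounds [mC] sum to more than [N - #|I|] and the coordinates to [N], so no coordinate
   exceeds its bound by [#|I|]. *)
have mC_max i p : inl p \in X -> val p i <= mC i + #|I|.
  move=> pX; have : \sum_(j | j != i) mC j <= \sum_(j | j != i) val p j.
    by apply: leq_sum => j _; apply: mC_min.
  have := valP p; rewrite /grid_point => /eqP; rewrite (bigD1 i) //=.
  by move: N_lt; rewrite (bigD1 i) //=; lia.
exists (val p1) => [|i]; first exact: valP.
have [iC|iC] := boolP (i \in C); last first.
  by left; have := mC_max i _ p1X; rewrite /mC (negbTE iC).
right; have : i \in col @: X by rewrite colX inE.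
case/imsetP => -[q|j] xX iq; last by move: iC; rewrite inE iq xX.
exists (val q); split=> [|//|j]; first exact: valP.
split; [apply: leq_trans (mC_max j _ p1X) _|apply: leq_trans (mC_max j _ xX) _];
  by rewrite leq_add2r; apply: mC_min.
Qed.
End Grid.

(* Compactness of the simplex and a KKM-type covering theorem *)
From mathcomp Require Import boolp classical_sets topology normedtype lra.

Import Order.TTheory GRing.Theory Num.Theory.
Import numFieldTopology.Exports numFieldNormedType.Exports.
Local Open Scope ring_scope.

Local Open Scope classical_set_scope.

Lemma closed_le_continuous (R : realType) (T : topologicalType) (f g : T -> R) :
  continuous f -> continuous g -> closed [set z | f z <= g z].
Proof.
move=> fc gc; rewrite (_ : [set _ | _] = (fun z => g z - f z) @^-1` [set x | 0 <= x]).
  apply: preimage_closed; last exact: closed_ge.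
  by move=> z _; apply: continuousB; [apply: gc|apply: fc].
by apply/seteqP; split=> z /=; rewrite subr_ge0.
Qed.

Lemma continuous_sum (R : realType) (T : topologicalType) (I : Type) (r : seq I)
  (P : pred I) (f : I -> T -> R) :
  (forall i, P i -> continuous (f i)) -> continuous (fun z => \sum_(i <- r | P i) f i z).
Proof. by apply: continuous_big; apply: add_continuous. Qed.

Lemma continuous_prod (R : realType) (T : topologicalType) (I : Type) (r : seq I)
  (P : pred I) (f : I -> T -> R) :
  (forall i, P i -> continuous (f i)) -> continuous (fun z => \prod_(i <- r | P i) f i z).
Proof. by apply: continuous_big; apply: mul_continuous. Qed.

Lemma continuous_mul (R : realType) (T : topologicalType) (f g : T -> R) :
  continuous f -> continuous g -> continuous (fun z => f z * g z).
Proof. by move=> fc gc z; apply: continuousM; [apply: fc|apply: gc]. Qed.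

Section Simplex.
Variables (R : realType) (m : nat).
Hypothesis m_gt0 : (0 < m)%N.

Definition simplex : set 'rV[R]_m :=
  [set z | (forall i, 0 <= z ord0 i) /\ \sum_i z ord0 i = 1].

Lemma compact_simplex : compact simplex.
Proof.
have cA : compact [set z : 'rV[R]_m | forall i, (`[0, 1]%classic : set R) (z ord0 i)].
  by apply: (@rV_compact R m (fun=> (`[0, 1]%classic : set R))) => i;
    apply: segment_compact.
have c1 : continuous (fun z : 'rV[R]_m => \sum_i z ord0 i).
  by apply: continuous_sum => i _; apply: coord_continuous.
have cc (a : R) : continuous (fun z : 'rV[R]_m => a) by exact: cst_continuous.
apply: (subclosed_compact _ cA).
  rewrite (_ : simplex = \bigcap_(i : 'I_m) [set z : 'rV[R]_m | 0 <= z ord0 i]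
    `&` ([set z | \sum_i z ord0 i <= 1] `&` [set z | 1 <= \sum_i z ord0 i])).
    apply: closedI; last by apply: closedI; apply: closed_le_continuous.
    apply: closed_bigI => i _.
    by apply: closed_le_continuous => //; apply: coord_continuous.
  apply/seteqP; split=> z [z0 z1].
    by split=> [i _|]; [apply: z0|rewrite /= z1].
  by split=> [i|]; [apply: z0|apply/eqP; rewrite eq_le; apply/andP].
move=> z [z0 z1] i; rewrite /= in_itv /= z0 /= -z1 (bigD1 i) //= lerDl.
by apply: sumr_ge0.
Qed.

(** The grid size is [N.+1], hence the range ['I_N.+2]: the mesh is then defined for every [N]. *)
Lemma simplex_grid_point N (p : {ffun 'I_m -> 'I_N.+2}) :
  grid_point p -> simplex (\row_i ((p i)%:R / N.+1%:R)).
Proof.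
move=> /eqP pN; split=> [i|]; first by rewrite mxE divr_ge0.
under eq_bigr do rewrite mxE.
by rewrite -mulr_suml -natr_sum pN divff // pnatr_eq0.
Qed.

(** Each grid point is coloured by the index of a set [K i] containing it; the error [m] of
    [colourful_grid_points] is then divided by the grid size. *)
Lemma simplex_approx (K : 'I_m -> set 'rV[R]_m) (N : nat) :
  (forall z, simplex z -> exists i, K i z) ->
  exists z, simplex z /\ forall i, z ord0 i <= m%:R / N.+1%:R \/
    exists w, K i w /\ forall j, `|z ord0 j - w ord0 j| <= m%:R / N.+1%:R.
Proof.
move=> cover; pose pt (p : {ffun 'I_m -> 'I_N.+2}) : 'rV[R]_m :=
  \row_i ((p i)%:R / N.+1%:R).
have [c Hc] : exists c : {ffun 'I_m -> 'I_N.+2} -> 'I_m,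
    forall p, grid_point p -> K (c p) (pt p).
  apply: (@fin_all_exists _ _ (fun p i => grid_point p -> K i (pt p))) => p.
  have [/simplex_grid_point/cover [i Ki]|np] := boolP (grid_point p); first by exists i.
  (* An arbitrary colour for functions that are not grid points. *)
  by exists (Ordinal m_gt0).
have [|p pG Hp] := colourful_grid_points c; first by rewrite card_ord.
exists (pt p); split; first exact: simplex_grid_point.
move=> i; have := Hp i; rewrite card_ord => -[pi|[q [qG <- pq]]].
  by left; rewrite mxE ler_wpM2r ?invr_ge0 // ler_nat.
right; exists (pt q); split=> [|j]; first exact: Hc.
have [] := pq j; rewrite !mxE -!(ler_nat R) !natrD => h1 h2.
rewrite -mulrBl normrM [X in _ * X]ger0_norm ?invr_ge0 // ler_wpM2r ?invr_ge0 //.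
by rewrite ler_norml; apply/andP; split; lra.
Qed.

(** The point is a cluster point of the approximate solutions of [simplex_approx] as the mesh tends
    to 0. *)
Lemma closed_cover_complementary (K : 'I_m -> set 'rV[R]_m) :
  (forall i, closed (K i)) -> (forall z, simplex z -> exists i, K i z) ->
  exists2 z, simplex z & forall i, z ord0 i = 0 \/ K i z.
Proof.
move=> cK cover.
have [z Hz] := choice (fun N => @simplex_approx K N cover).
have [] := @compact_simplex (z @ \oo) _ _.
  by exists 0%N => // N _; apply: (proj1 (Hz N)).
move=> p [ps pc]; exists p => // i.
apply: contrapT => /not_orP [/eqP p0 nK].
have pi0 : 0 < p ord0 i by rewrite lt_neqAle eq_sym p0; apply: (proj1 ps).
have : nbhs p (~` K i) by apply: open_nbhs_nbhs; split=> //; apply: closed_openC.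
move=> /nbhs_ballP [e /= e0 eK].
(* The bound [e / 2] keeps [w], reached from [p] through [z N], in the ball avoiding [K i]; the
   bound [p ord0 i / 2] excludes a small coordinate [i] of [z N]. *)
have [d [d0 de dpi]] : exists d, [/\ 0 < d, d <= e / 2 & d <= p ord0 i / 2].
  exists (Num.min (e / 2) (p ord0 i / 2)).
  by rewrite ge_min lexx ge_min lexx orbT lt_min !divr_gt0.
have [N0 HN0] : exists N0, forall N, (N0 <= N)%N -> m%:R / N.+1%:R < d.
  exists (Num.bound (m%:R / d)) => N N0N.
  rewrite ltr_pdivrMr // mulrC -ltr_pdivrMr //.
  apply: lt_le_trans (archi_boundP _) _; first by rewrite divr_ge0 // ltW.
  by rewrite ler_nat ltnW.
have zF : (z @ \oo) (z @` [set N | (N0 <= N)%N]) by exists N0 => // N N0N; exists N.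
have [v [[N N0N <-] [_ pz]]] := pc _ _ zF (nbhsx_ballx p d d0).
have dN := HN0 N N0N.
have [zi|[w [Kw zw]]] := proj2 (Hz N) i.
  have := pz ord0 i; rewrite /ball /= ltr_norml => /andP [_].
  move: (p ord0 i) (z N ord0 i) (_ / N.+1%:R) dpi zi dN => a b c; lra.
apply: (eK w) Kw; split=> // k j; rewrite ord1.
rewrite /ball /=; apply: le_lt_trans (ler_distD (z N ord0 j) _ _) _.
have -> : e = e / 2 + e / 2 by rewrite -splitr.
by apply: ltr_leD; [apply: lt_le_trans (pz _ _) de|];
  apply: le_trans (zw j) (le_trans (ltW dN) de).
Qed.
End Simplex.

(* Expected payoffs and existence of an equilibrium *)
Local Close Scope classical_set_scope.

(** Serves to show that the opponents' product distribution has total mass 1. *)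
Lemma prod_sum_dffun (R : comPzSemiRingType) (I : finType) (T : I -> finType)
  (F : forall i, T i -> R) :
  \prod_i \sum_(j : T i) F i j = \sum_(f : {dffun forall i, T i}) \prod_i F i (f i).
Proof.
rewrite [RHS](reindex (@dffun_of_fprod _ T)); last exact/onW_bij/dffun_of_fprod_bij.
under [RHS]eq_bigr do under eq_bigr do rewrite ffunE -(ffunE (F _)).
rewrite (big_fprod _ _ (fun i => [ffun j => F i j])).
under eq_bigr do rewrite big_tag; rewrite (bigA_distr_big_dep _ (fun i => untag 0 (F i))).
apply: eq_bigr => f _; apply: eq_bigr => i _; rewrite /untag; case: eqP => // e.
by rewrite ffunE.
Qed.

Section Game.
Variables (R : realType) (n : nat) (S : 'I_n -> finType).
Variable A : 'I_n -> pure_profile S -> R.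

Lemma mixed_gt0 (i : 'I_n) (y : S i -> R) :
  is_mixed_strategy y -> exists s, 0 < y s.
Proof.
move=> [y0 y1]; apply/existsP; apply: contraT; rewrite negb_exists => /forallP H.
have : \sum_s y s <= 0 by apply: sumr_le0 => s _; rewrite leNgt.
by rewrite y1 leNgt ltr01.
Qed.

Lemma pure_payoff_dfwith (x : mixed_profile R S) (i : 'I_n) (y s : _) :
  pure_payoff A (dfwith x (y : S i -> R)) (s : S i) = pure_payoff A x s.
Proof.
apply: eq_bigr => t _; congr (_ * _); apply: eq_bigr => j _.
by rewrite dfwith_out // eq_sym (valP j).
Qed.

(** The expected payoff is the average, with weights [x i], of pure payoffs that do not depend on
    [x i]. Such an average is maximal exactly when all weight lies on maximizers. *)
Lemma nash_equilibriumP (x : mixed_profile R S) :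
  nash_equilibrium A x <-> (forall i, is_mixed_strategy (x i)) /\
    (forall i (s : S i), x i s = 0 \/
       forall t : S i, pure_payoff A x t <= pure_payoff A x s).
Proof.
split=> -[xm H]; split=> //.
  move=> i s; have [x0|x0] := eqVneq (x i s) 0; [by left|right].
  pose t0 := [arg max_(t > s) @pure_payoff R n S A x i t]%O.
  have t0max (t : S i) : pure_payoff A x t <= pure_payoff A x t0.
    by rewrite /t0; case: arg_maxP => // u _; apply.
  suff -> : pure_payoff A x s = pure_payoff A x t0 by [].
  pose y (t : S i) : R := (t == t0)%:R.
  have ym : is_mixed_strategy y.
    split=> [t|]; first exact: ler0n.
    by rewrite (bigD1 t0) //= /y eqxx big1 ?addr0 // => t /negbTE ->.
  have := H i y ym; rewrite /expected_payoff.
  under eq_bigr do rewrite pure_payoff_dfwith dfwith_in.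
  rewrite (bigD1 t0) //= /y eqxx mul1r big1 ?addr0 => [Hle|t /negbTE ->];
    last by rewrite mul0r.
  (* The terms are nonnegative and, by the deviation to [t0], sum to at most 0; so each of them
     vanishes. *)
  have S0 : \sum_t x i t * (pure_payoff A x t0 - pure_payoff A x t) = 0.
    apply/eqP; rewrite eq_le sumr_ge0 ?andbT => [|t _]; last first.
      by rewrite mulr_ge0 ?subr_ge0 //; apply: (proj1 (xm i)).
    under eq_bigr do rewrite mulrBr.
    by rewrite big_split /= sumrN -mulr_suml (proj2 (xm i)) mul1r subr_le0.
  move/eqP: S0; rewrite psumr_eq0 => [/allP/(_ s)|t _]; last first.
    by rewrite mulr_ge0 ?subr_ge0 //; apply: (proj1 (xm i)).
  by rewrite mem_index_enum mulf_eq0 (negbTE x0) subr_eq0 => /(_ isT) /eqP.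
move=> i y ym; rewrite /expected_payoff.
under eq_bigr do rewrite pure_payoff_dfwith dfwith_in.
have [s0 s0_gt0] := mixed_gt0 (xm i).
have s0max (t : S i) : pure_payoff A x t <= pure_payoff A x s0.
  by have [s00|//] := H i s0; rewrite s00 ltxx in s0_gt0.
have -> : \sum_s x i s * pure_payoff A x s = pure_payoff A x s0.
  rewrite -[RHS]mul1r -(proj2 (xm i)) mulr_suml; apply: eq_bigr => s _.
  have [->|smax] := H i s; first by rewrite !mul0r.
  by congr (_ * _); apply/eqP; rewrite eq_le s0max smax.
rewrite -[leRHS]mul1r -(proj2 ym) mulr_suml; apply: ler_sum => s _.
by rewrite ler_wpM2l // (proj1 ym).
Qed.

Lemma sum_opponents (x : mixed_profile R S) (i : 'I_n) :
  (forall i, is_mixed_strategy (x i)) ->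
  \sum_(t : others S i) \prod_(j : {j : 'I_n | j != i}) x (val j) (t j) = 1.
Proof.
move=> xm; rewrite -(@prod_sum_dffun R _ (fun j => S (val j)) (fun j => x (val j))).
by rewrite big1 // => j _; apply: (proj2 (xm _)).
Qed.

Lemma payoff_diff_le (i : 'I_n) (s s' : S i) (t t' : others S i) :
  A i (join s t) - A i (join s' t') <= max_payoff_diff A i.
Proof. exact: (le_bigmax _ _ ((s', t'), (s, t))). Qed.

(** Both payoffs average over the same opponents' distribution, so the bound passes from pure
    profiles to averages. *)
Lemma pure_payoff_diff_le (x : mixed_profile R S) (i : 'I_n) (s s' : S i) :
  (forall i, is_mixed_strategy (x i)) ->
  pure_payoff A x s - pure_payoff A x s' <= max_payoff_diff A i.
Proof.
move=> xm; rewrite /pure_payoff -sumrB -[leRHS]mul1r.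
rewrite -[X in _ <= X * _](sum_opponents i xm) mulr_suml.
apply: ler_sum => t _; rewrite -mulrBr ler_wpM2l ?payoff_diff_le //.
by apply: prodr_ge0 => j _; apply: (proj1 (xm _)).
Qed.

Hypothesis S_nonempty : forall i : 'I_n, (0 < #|S i|)%N.

Lemma nash_equilibrium_exists : (0 < n)%N -> exists x, nash_equilibrium A x.
Proof.
move=> n_gt0; pose T : finType := {i : 'I_n & S i}.
pose ix i (s : S i) : 'I_#|T| := enum_rank (Tagged (fun i => S i : Type) s).
(* This is a mixed profile only if every player has weight 1/n; the payoffs are polynomials in [z],
   hence defined and continuous everywhere. *)
pose prof (z : 'rV[R]_#|T|) : mixed_profile R S := fun i s => n%:R * z ord0 (ix i s).
have n0 : 0 < n%:R :> R by rewrite ltr0n.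
have sum_ix (z : 'rV[R]_#|T|) : \sum_k z ord0 k = \sum_i \sum_(s : S i) z ord0 (ix i s).
  rewrite (reindex (@enum_rank T)); last exact/onW_bij/enum_rank_bij.
  rewrite sig_big_dep /=; apply: eq_bigr => -[i s] _ //.
pose K (k : 'I_#|T|) : set 'rV[R]_#|T| :=
  let: existT i s := enum_val k in
  ([set z : 'rV[R]_#|T| | \sum_t z ord0 (ix i t) <= n%:R^-1] `&`
  \bigcap_(t : S i) [set z : 'rV[R]_#|T| |
    pure_payoff A (prof z) t <= pure_payoff A (prof z) s])%classic.
have T_gt0 : (0 < #|T|)%N.
  have /card_gt0P [s _] := S_nonempty (Ordinal n_gt0).
  by apply/card_gt0P; exists (Tagged (fun i => S i : Type) s).
have KE z i s : K (ix i s) z <-> \sum_t z ord0 (ix i t) <= n%:R^-1 /\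
    forall t : S i, pure_payoff A (prof z) t <= pure_payoff A (prof z) s.
  rewrite /K /ix enum_rankK /=; split=> -[h1 h2]; split=> // t; first exact: h2.
  by move=> _; apply: h2.
have cont_prof i s : continuous (fun z : 'rV[R]_#|T| => prof z i s : R).
  by apply: continuous_mul; [exact: cst_continuous|exact: coord_continuous].
have cont_pay i (s : S i) :
    continuous (fun z : 'rV[R]_#|T| => pure_payoff A (prof z) s : R).
  apply: continuous_sum => t _; apply: continuous_mul; last exact: cst_continuous.
  by apply: continuous_prod => j _; apply: cont_prof.
have [k|z zs|z [z0 z1] zK] := @closed_cover_complementary R _ T_gt0 K.
- rewrite /K; case: (enum_val k) => i s; apply: closedI.
    apply: closed_le_continuous; last exact: cst_continuous.
    by apply: continuous_sum => t _; apply: coord_continuous.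
  by apply: closed_bigI => t _; apply: closed_le_continuous.
(* Of [n] weights with sum 1, one is at most 1/n; a best reply of that player gives the covering
   set. *)
- have [i Hi] : exists i, \sum_t z ord0 (ix i t) <= n%:R^-1.
    apply/existsP; apply: contraT; rewrite negb_exists => /forallP H.
    suff : \sum_(i < n) n%:R^-1 < 1 :> R.
      by rewrite sumr_const card_ord -(mulr_natr n%:R^-1) mulVf ?ltxx // gt_eqF.
    rewrite -[X in _ < X](proj2 zs) sum_ix; apply: ltr_sum => [|i _];
      last by rewrite ltNge.
    by apply/hasP; exists (Ordinal n_gt0) => //; rewrite mem_index_enum.
  have /card_gt0P [s0 _] := S_nonempty i.
  exists (ix i [arg max_(t > s0) @pure_payoff R n S A (prof z) i t]%O).
  by apply/KE; split=> // t; case: arg_maxP => // u _; apply.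
have zK' i s : z ord0 (ix i s) = 0 \/ \sum_t z ord0 (ix i t) <= n%:R^-1 /\
    forall t : S i, pure_payoff A (prof z) t <= pure_payoff A (prof z) s.
  by have [|/KE] := zK (ix i s); [left|right].
have sum_le i : \sum_t z ord0 (ix i t) <= n%:R^-1.
  have [/existsP [s]|/existsPn zs0] := boolP [exists s, z ord0 (ix i s) != 0].
    by case: (zK' i s) => [->|[]//]; rewrite eqxx.
  rewrite big1 ?invr_ge0 ?ltW // => s _; apply/eqP; rewrite -[_ == _]negbK; exact: zs0.
have sum_eq i : \sum_t z ord0 (ix i t) = n%:R^-1.
  have S0 : \sum_i (n%:R^-1 - \sum_t z ord0 (ix i t)) = 0.
    by rewrite sumrB -sum_ix z1 sumr_const card_ord
      -(mulr_natr n%:R^-1) mulVf ?subrr // gt_eqF.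
  move/eqP: S0; rewrite psumr_eq0 => [/allP/(_ i)|j _]; last by rewrite subr_ge0.
  by rewrite mem_index_enum subr_eq0 => /(_ isT) /eqP.
exists (prof z); apply/nash_equilibriumP; split=> [i|i s].
  split=> [s|]; first by rewrite mulr_ge0 ?ler0n.
  by rewrite -mulr_sumr sum_eq mulfV // gt_eqF.
by have [zis|[]] := zK' i s; [left; rewrite /prof zis mulr0|right].
Qed.

(** * The optimization problem and its optimal value *)

Lemma feasible_ge1 (v : variables R S) (i : 'I_n) (s : S i) :
  0 < max_payoff_diff A i -> feasible A v -> 1 <= var_f v s + var_g v s.
Proof.
move=> Ui [_ /(_ i s)] [_ [_ [_ [x0 [r0 [fr [fb [gx gb]]]]]]]].
have f0 : 0 <= var_f v s by apply: le_trans fr; rewrite divr_ge0 // ltW.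
(* If [b] is 1, then [f] is at least 1 and [g] at least 0 through [x]; if [b] is 0, then [g] is at
   least 1 and [f] at least 0 through the regret. *)
by case: (var_b v s) fb gb => /=; lra.
Qed.

Hypothesis U_pos : forall i : 'I_n, 0 < max_payoff_diff A i.

Lemma objective_ge (v : variables R S) :
  feasible A v -> \sum_i #|S i|%:R <= objective v.
Proof.
move=> vf; apply: ler_sum => i _; rewrite -sum1_card natr_sum.
by apply: ler_sum => s _; apply: feasible_ge1.
Qed.

Lemma nash_feasible (x : mixed_profile R S) : nash_equilibrium A x ->
  exists r u ubar f g b, feasible A (Variables x r u ubar f g b) /\
    objective (Variables x r u ubar f g b) = \sum_i #|S i|%:R.
Proof.
move=> /nash_equilibriumP [xm xbr].
have [best Hbest] : exists best : 'I_n -> R, forall i,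
    (exists s0 : S i, best i = pure_payoff A x s0) /\
    (forall t : S i, pure_payoff A x t <= best i).
  apply: (@fin_all_exists _ _ (fun i b => (exists s0 : S i, b = pure_payoff A x s0) /\
    (forall t : S i, pure_payoff A x t <= b))) => i.
  have [s s0] := mixed_gt0 (xm i).
  have [x0|H] := xbr i s; first by rewrite x0 ltxx in s0.
  by exists (pure_payoff A x s); split=> //; exists s.
pose r i (s : S i) := best i - pure_payoff A x s.
(* With [f = b] and [g = 1 - b] each pair contributes 1. Nonzero regret forces [x i s = 0], so
   [g = 0] is allowed, and [f = 1] suffices because no regret exceeds [max_payoff_diff A i]. *)
pose b i (s : S i) := r i s != 0.
exists r, (fun i s => pure_payoff A x s), best.
exists (fun i s => (b i s)%:R), (fun i s => 1 - (b i s)%:R), b; split; last first.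
  apply: eq_bigr => i _; rewrite -sum1_card natr_sum; apply: eq_bigr => s _ /=.
  by rewrite addrC subrK.
split=> [i|i s] /=; first exact: (proj2 (xm i)).
have [[s0 bs0] bmax] := Hbest i.
have r0 : 0 <= r i s by rewrite subr_ge0.
have x1 : x i s <= 1.
  by rewrite -(proj2 (xm i)) (bigD1 s) //= lerDl sumr_ge0 // => t _;
    apply: (proj1 (xm i)).
do 3!split=> //; split; first exact: (proj1 (xm i)).
split=> //; split; last split=> //; last split=> //.
  rewrite ler_pdivrMr // /b; case: eqP => [->|_] /=; first by rewrite mul0r.
  by rewrite mul1r /r bs0 pure_payoff_diff_le.
rewrite /b; case: eqP => [_|rn0] /=; first by rewrite subr0.
have [->|sbr] := xbr i s; first by rewrite subrr.
by case: rn0; apply/eqP; rewrite eq_le r0 subr_le0 bs0 sbr.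
Qed.

Lemma minimal_feasible_nash (v : variables R S) : feasible A v ->
  objective v <= \sum_i #|S i|%:R -> nash_equilibrium A (var_x v).
Proof.
move=> vf ov.
have fg1 i (s : S i) : var_f v s + var_g v s = 1.
  have ge1 j (t : S j) : 0 <= var_f v t + var_g v t - 1.
    by rewrite subr_ge0 feasible_ge1.
  have S0 : \sum_j \sum_(t : S j) (var_f v t + var_g v t - 1) = 0.
    apply/eqP; rewrite eq_le; apply/andP; split; last by do 2!apply: sumr_ge0 => ? _.
    under eq_bigr do rewrite sumrB sumr_const.
    by rewrite sumrB subr_le0.
  move/eqP: S0; rewrite psumr_eq0 => [/allP/(_ i)|j _]; last by apply: sumr_ge0.
  rewrite mem_index_enum /= psumr_eq0 // => /(_ isT) /allP/(_ s).
  by rewrite mem_index_enum subr_eq0 => /(_ isT) /eqP.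
have [sx vc] := vf.
apply/nash_equilibriumP; split=> [i|i s].
  by split=> // s; have [_ [_ [_ []]]] := vc i s.
have [us [_ [rs [x0 [r0 [fr [fb [gx gb]]]]]]]] := vc i s.
(* Equality to 1 leaves no room: [b = 1] forces [x = 0], and [b = 0] forces [f] and thus the regret
   down to 0. *)
have := fg1 i s; case: (var_b v s) fb gb => /= fb gb fg.
  by left; lra.
right=> t; have [ut [ubt _]] := vc i t.
have : var_r v s / max_payoff_diff A i <= 0 by lra.
by rewrite ler_pdivrMr // mul0r rs subr_le0 -us -ut; apply: le_trans.
Qed.

End Game.

Theorem proposition6 (R : realType) (n : nat) (S : 'I_n -> finType)
  (A : 'I_n -> pure_profile S -> R)
  (n_ge2 : (2 <= n)%N)
  (S_nonempty : forall i : 'I_n, (0 < #|S i|)%N)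
  (U_pos : forall i : 'I_n, 0 < max_payoff_diff A i)
  (x : mixed_profile R S) :
  nash_equilibrium A x <->
  exists (r u : forall i : 'I_n, S i -> R) (ubar : 'I_n -> R)
         (f g : forall i : 'I_n, S i -> R) (b : forall i : 'I_n, S i -> bool),
    optimal A (Variables x r u ubar f g b).
Proof.
split=> [/(nash_feasible U_pos)|].
  move=> [r [u [ubar [f [g [b [vf vo]]]]]]]; exists r, u, ubar, f, g, b.
  by split=> // w wf; rewrite vo; apply: (objective_ge U_pos).
move=> [r [u [ubar [f [g [b [vf vopt]]]]]]].
(* An existing equilibrium shows that the lower bound is attained, so every optimal solution attains
   it. *)
have [y /(nash_feasible U_pos)] := nash_equilibrium_exists A S_nonempty (ltnW n_ge2).
move=> [r' [u' [ubar' [f' [g' [b' [wf wo]]]]]]].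
by apply: (minimal_feasible_nash U_pos vf); rewrite -wo; apply: vopt.
Qed.
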